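(* There exist a CAD cell $C$ in $\mathbb{R}^4$ and a point $\mathbf{x}\in\overline{\pi_3(C)}$ such that the fibre $(\pi_3|_{\overline{C}})^{-1}(\{\mathbf{x}\})$ consists of exactly two points. In particular, this fibre is not a closed segment.
   Context: For $k\le n$, $\pi_k:\mathbb{R}^n\to\mathbb{R}^k$ is the projection onto the first $k$ coordinates. Closures are taken in the Euclidean topology. For $S\subseteq\mathbb{R}^n$, $\mathcal{S}^0(S)$ denotes the ring of continuous semi-algebraic functions $S\to\mathbb{R}$. For $f\in\mathcal{S}^0(S)$, the section with base $S$ and bound $f$ is the graph $S\odot\{f\}=\{(\mathbf{x},y)\in\mathbb{R}^{n+1} : \mathbf{x}\in S,\ y=f(\mathbf{x})\}$. For $l\in\mathcal{S}^0(S)\cup\{-\infty\}$ and $u\in\mathcal{S}^0(S)\cup\{+\infty\}$ with $l<u$ on $S$, the sector with base $S$ and bounds $l,u$ is $S\odot(l,u)=\{(\mathbf{x},y)\in\mathbb{R}^{n+1} : \mathbf{x}\in S,\ l(\mathbf{x})<y<u(\mathbf{x})\}$. CAD cells are defined inductively: a CAD cell of $\mathbb{R}$ is either a singleton $\{\xi\}$ with $\xi$ real algebraic, or a nonempty open interval whose endpoints are real algebraic numbers or $\pm\infty$; for $n>1$, a CAD cell of $\mathbb{R}^n$ is a section or a sector whose base is a CAD cell of $\mathbb{R}^{n-1}$. *)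

(* Defs.v *)
From HB Require Import structures.
From mathcomp Require Import all_boot all_order all_algebra.
From mathcomp Require mpoly.
From mathcomp Require Import all_classical all_reals all_analysis.
Set Implicit Arguments.
Unset Strict Implicit.
Unset Printing Implicit Defensive.
Import Order.TTheory GRing.Theory Num.Theory.
Import numFieldNormedType.Exports.
Local Open Scope classical_set_scope.
Local Open Scope ring_scope.

Definition coord_proj (R : realType) (k n : nat) (h : (k <= n)%N) (x : 'rV[R]_n) :
  'rV[R]_k := colsub (widen_ord h) x.

(* A point (x, y) of R^(n+1) with x in R^n and y in R is a row vector z with  *)
(* x = coord_proj (leqnSn n) z and y = z 0 ord_max.                           *)

(* The Boolean algebra of subsets of R^n generated by the sets {p > 0}, with  *)
(* p a polynomial with real coefficients; {p = 0} is the complement of        *)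
(* {p > 0} `|` {- p > 0}.                                                     *)
Inductive semialgebraic (R : realType) (n : nat) : set 'rV[R]_n -> Prop :=
| semialgebraic_pos (p : mpoly.mpoly n R) :
    semialgebraic [set x | 0 < mpoly.meval (fun i => x 0 i) p]
| semialgebraicC (A : set 'rV[R]_n) :
    semialgebraic A -> semialgebraic (~` A)
| semialgebraicU (A B : set 'rV[R]_n) :
    semialgebraic A -> semialgebraic B -> semialgebraic (A `|` B)
| semialgebraicI (A B : set 'rV[R]_n) :
    semialgebraic A -> semialgebraic B -> semialgebraic (A `&` B).

Definition cad_section (R : realType) (n : nat) (S : set 'rV[R]_n)
    (f : 'rV[R]_n -> R) : set 'rV[R]_n.+1 :=
  [set z | S (coord_proj (leqnSn n) z) /\ z 0 ord_max = f (coord_proj (leqnSn n) z)].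

Definition cad_sector (R : realType) (n : nat) (S : set 'rV[R]_n)
    (l u : 'rV[R]_n -> \bar R) : set 'rV[R]_n.+1 :=
  [set z | S (coord_proj (leqnSn n) z) /\
    (l (coord_proj (leqnSn n) z) < (z 0 ord_max)%:E < u (coord_proj (leqnSn n) z))%E].

(* Functions on S are total functions of which only the values on S matter;   *)
(* such a function is semi-algebraic on S when its graph over S is.           *)
Definition continuous_semialgebraic (R : realType) (n : nat)
    (S : set 'rV[R]_n) (f : 'rV[R]_n -> R) : Prop :=
  {within S, continuous f} /\ semialgebraic (cad_section S f).

Definition sector_lower_bound (R : realType) (n : nat) (S : set 'rV[R]_n)
    (l : 'rV[R]_n -> \bar R) : Prop :=
  l = cst -oo%E \/
  exists2 f, continuous_semialgebraic S f & l = EFin \o f.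

Definition sector_upper_bound (R : realType) (n : nat) (S : set 'rV[R]_n)
    (u : 'rV[R]_n -> \bar R) : Prop :=
  u = cst +oo%E \/
  exists2 f, continuous_semialgebraic S f & u = EFin \o f.

Definition real_algebraic (R : realType) (x : R) : Prop :=
  algebraicOver (ratr : rat -> R) x.

Definition algebraic_or_infinite (R : realType) (x : \bar R) : Prop :=
  [\/ x = -oo%E, x = +oo%E | exists2 r, real_algebraic r & x = r%:E].

(* There are no cells in R^0, so that the last two constructors only produce  *)
(* cells of R^n with n > 1.                                                   *)
Inductive cad_cell (R : realType) : forall n : nat, set 'rV[R]_n -> Prop :=
| cad_cell_point (xi : R) :
    real_algebraic xi ->
    cad_cell [set z : 'rV[R]_1 | z 0 0 = xi]
| cad_cell_interval (a b : \bar R) :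
    algebraic_or_infinite a -> algebraic_or_infinite b -> (a < b)%E ->
    cad_cell [set z : 'rV[R]_1 | (a < (z 0 0)%:E < b)%E]
| cad_cell_section (n : nat) (S : set 'rV[R]_n) (f : 'rV[R]_n -> R) :
    cad_cell S -> continuous_semialgebraic S f ->
    cad_cell (cad_section S f)
| cad_cell_sector (n : nat) (S : set 'rV[R]_n) (l u : 'rV[R]_n -> \bar R) :
    cad_cell S -> sector_lower_bound S l -> sector_upper_bound S u ->
    (forall x, S x -> (l x < u x)%E) ->
    cad_cell (cad_sector S l u).

(* The degenerate segments reduced to a point (a = b) are included.           *)
Definition closed_segment (R : realType) (n : nat) (A : set 'rV[R]_n) : Prop :=
  exists a b : 'rV[R]_n,
    A = [set (1 - t) *: a + t *: b | t in [set t : R | 0 <= t <= 1]].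

(* Main.v *)
Require Import Defs.
From HB Require Import structures.
From mathcomp Require Import all_boot all_order all_algebra.
From mathcomp Require Import all_classical all_reals all_analysis.
From mathcomp Require mpoly.
Import(canonicals) mpoly.
From mathcomp Require Import ring lra.
Import Order.TTheory GRing.Theory Num.Theory.
Import numFieldNormedType.Exports.
Local Open Scope classical_set_scope.
Local Open Scope ring_scope.

(** Take the surface [z = (y / x)^2] over the half-plane [x > 0], and let [C]
    be the graph of [w = y / x] over it. On [C] one has [z = w^2], a closed
    condition, so above the limit point [(0, 0, 1)] only [w = 1] and [w = -1]
    can occur; both do, as limits along the rays [(t, t, 1, 1)] and
    [(t, -t, 1, -1)]. *)

Definition mpoly_var (R : nzRingType) (n : nat) (i : 'I_n) : mpoly.mpoly n R :=
  mpoly.mpolyX R (mpoly.mnm1 i).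

Section Semialgebraic.
Variables (R : realType) (n : nat).

Lemma semialgebraic_ext (A B : set 'rV[R]_n) :
  (forall x, A x <-> B x) -> semialgebraic A -> semialgebraic B.
Proof. by move=> AB; suff -> : A = B by []; apply/seteqP; split=> x /AB. Qed.

(** The generators are strict inequalities only, so an equation is the complement of [p > q] or
    [q > p]. The graphs below are cut out by such equations. *)
Lemma semialgebraic_eq (p q : mpoly.mpoly n R) :
  semialgebraic [set x : 'rV[R]_n |
    mpoly.meval (fun i => x 0 i) p = mpoly.meval (fun i => x 0 i) q].
Proof.
apply: semialgebraic_ext (semialgebraicC (semialgebraicU
  (semialgebraic_pos (p - q)) (semialgebraic_pos (q - p)))).
move=> x /=; rewrite !mpoly.mevalB !subr_gt0; split.
  move=> npq; apply/eqP; apply: contra_notT npq.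
  by rewrite neq_lt => /orP[]; [right|left].
by move=> ->; rewrite ltxx => -[].
Qed.

Lemma semialgebraic_coord_gt0 (i : 'I_n) :
  semialgebraic [set x : 'rV[R]_n | 0 < x 0 i].
Proof.
apply: semialgebraic_ext (semialgebraic_pos (mpoly_var R n i)).
by move=> x /=; rewrite mpoly.mevalXU.
Qed.

End Semialgebraic.

(** As [t] tends to 0 from the right, [a + t *: b] tends to [a], so every neighbourhood of [a] meets
    the ray at some [t > 0]. *)
Lemma closure_ray (R : realType) (n : nat) (A : set 'rV[R]_n)
    (a b : 'rV[R]_n) :
  (forall t : R, 0 < t -> A (a + t *: b)) -> closure A a.
Proof.
move=> Aab B Ba.
have ray_cvg : (fun t : R => a + t *: b) @ 0^'+ --> a.
  apply: cvg_at_right_filter; rewrite -[X in _ --> X]addr0 -(scale0r b).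
  by apply: cvgD; [exact: cvg_cst|apply: cvgZr_tmp; exact: cvg_id].
have Bray : \forall t \near (0 : R)^'+, B (a + t *: b) := ray_cvg B Ba.
have [t [Bt t0]] := filter_ex (filterI Bray (nbhs_right_gt (0 : R))).
by exists (a + t *: b); split; [exact: Aab|].
Qed.

(** A segment is convex, so it would contain the midpoint of [p] and [q]; that midpoint equals [p]
    or [q] only when [p = q]. *)
Lemma doubleton_not_closed_segment (R : realType) (n : nat) (p q : 'rV[R]_n) :
  p <> q -> ~ closed_segment [set p; q].
Proof.
move=> pq [a [b Eab]].
have on_segment v : [set p; q] v ->
    exists2 t : R, 0 <= t <= 1 & (1 - t) *: a + t *: b = v.
  by rewrite Eab => -[t] /= t01 tv; exists t.
have [s s01 sp] := on_segment p (or_introl erefl).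
have [t t01 tq] := on_segment q (or_intror erefl).
have : [set p; q] (2^-1 *: (p + q)).
  (* The segment is parametrised affinely, so the midpoint sits at the mean of the parameters of [p]
     and [q]. *)
  rewrite Eab; exists ((s + t) / 2) => /=; first by lra.
  by rewrite -sp -tq; apply/rowP => i; rewrite !mxE; field.
by case=> /rowP mid; apply: pq; apply/rowP => i; move: (mid i); rewrite !mxE; lra.
Qed.

Section Cell.
Variable R : realType.

(** The dimension is left free so that the same quotient can be read on the half-plane, on the
    surface and on the cell. *)
Definition slope (n : nat) (v : 'rV[R]_n.+2) : R := v 0 1 / v 0 0.

(** Written with extended reals to match the interval constructor of [cad_cell]. *)
Definition half_line : set 'rV[R]_1 :=
  [set z | (0%:E < (z 0 0)%:E < +oo)%E].

Definition half_plane : set 'rV[R]_2 :=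
  cad_sector half_line (cst -oo%E) (cst +oo%E).

Definition slope_surface : set 'rV[R]_3 :=
  cad_section half_plane (fun v => slope 0 v ^+ 2).

Definition slope_cell : set 'rV[R]_4 := cad_section slope_surface (slope 1).

Lemma coord_projE (k n : nat) (h : (k <= n)%N) (v : 'rV[R]_n) (i : 'I_k) :
  coord_proj h v 0 i = v 0 (widen_ord h i).
Proof. by rewrite mxE. Qed.

Lemma slope_coord_proj (n : nat) (v : 'rV[R]_n.+3) :
  slope n (coord_proj (leqnSn n.+2) v) = slope n.+1 v.
Proof.
rewrite /slope !coord_projE.
by congr (v 0 _ / v 0 _); apply: val_inj.
Qed.

Lemma half_planeE : half_plane = [set v : 'rV[R]_2 | 0 < v 0 0].
Proof.
apply/seteqP; split=> v;
  rewrite /half_plane /cad_sector /half_line /= coord_projE ltNyr !ltry lte_fin;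
  rewrite ?andbT (_ : widen_ord _ _ = 0) //; try exact: val_inj.
by case.
Qed.

Lemma slope_surfaceE :
  slope_surface = [set v : 'rV[R]_3 | 0 < v 0 0 /\ v 0 ord_max = slope 1 v ^+ 2].
Proof.
rewrite /slope_surface half_planeE /cad_section.
apply/seteqP; split=> v /=; rewrite slope_coord_proj coord_projE;
  rewrite (_ : widen_ord _ _ = 0) //; exact: val_inj.
Qed.

Lemma slope_cellE :
  slope_cell = [set v : 'rV[R]_4 | [/\ 0 < v 0 0, v 0 2 = slope 2 v ^+ 2
                         & v 0 ord_max = slope 2 v]].
Proof.
rewrite /slope_cell slope_surfaceE /cad_section.
have e0 : widen_ord (leqnSn 3) 0 = 0 by exact: val_inj.
have e2 : widen_ord (leqnSn 3) ord_max = 2 by exact: val_inj.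
apply/seteqP; split=> v /=; rewrite slope_coord_proj !coord_projE e0 e2.
  by move=> [[]].
by move=> [].
Qed.

Lemma slope_continuous (n : nat) (v : 'rV[R]_n.+2) :
  0 < v 0 0 -> {for v, continuous (slope n)}.
Proof.
move=> v0; apply: continuousM; first exact: coord_continuous.
by apply: continuousV; [rewrite gt_eqF|exact: coord_continuous].
Qed.

Lemma cad_cell_half_plane : cad_cell half_plane.
Proof.
apply: cad_cell_sector; [|by left|by left|by []].
apply: cad_cell_interval; [|by constructor|exact: ltry].
by constructor 3; exists 0 => //; exact: algebraic0.
Qed.

Lemma cad_cell_slope_surface : cad_cell slope_surface.
Proof.
apply: cad_cell_section; first exact: cad_cell_half_plane.
split.
  apply: continuous_in_subspaceT => v; rewrite half_planeE inE /= => v0.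
  by apply: continuousM; exact: slope_continuous.
rewrite -/slope_surface slope_surfaceE.
(* Clearing the denominator, which is positive here, turns [z = (y / x)^2] into the polynomial
   equation [z * x^2 = y^2]. *)
apply: semialgebraic_ext (semialgebraicI (semialgebraic_coord_gt0 R 3 0)
  (semialgebraic_eq R 3 (mpoly_var R 3 ord_max * mpoly_var R 3 0 ^+ 2)
                        (mpoly_var R 3 1 ^+ 2))).
move=> v /=; rewrite !expr2 !mpoly.mevalM !mpoly.mevalXU /slope.
split=> -[v0 vE]; split=> //.
  have v00 : v 0 0 * v 0 0 != 0 by rewrite mulf_neq0 ?gt_eqF.
  by rewrite mulf_div -vE mulfK.
by rewrite vE; field; rewrite gt_eqF.
Qed.

Lemma cad_cell_slope_cell : cad_cell slope_cell.
Proof.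
apply: cad_cell_section; first exact: cad_cell_slope_surface.
split.
  apply: continuous_in_subspaceT => v; rewrite slope_surfaceE inE /= => -[v0 _].
  exact: slope_continuous.
rewrite -/slope_cell slope_cellE.
(* Over [x > 0] the cell is described by [z = w * w] and [w * x = y]. *)
apply: semialgebraic_ext (semialgebraicI (semialgebraic_coord_gt0 R 4 0)
  (semialgebraicI
    (semialgebraic_eq R 4 (mpoly_var R 4 2)
      (mpoly_var R 4 ord_max * mpoly_var R 4 ord_max))
    (semialgebraic_eq R 4 (mpoly_var R 4 ord_max * mpoly_var R 4 0)
      (mpoly_var R 4 1)))).
move=> v /=; rewrite !mpoly.mevalM !mpoly.mevalXU /slope; split.
  move=> [v0 [v2 v3]].
  have wE : v 0 ord_max = v 0 1 / v 0 0 by rewrite -v3 mulfK // gt_eqF.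
  by split=> //; rewrite -wE.
by move=> [v0 -> ->]; split=> //; split; field; rewrite gt_eqF.
Qed.

Definition fibre_point (s : R) : 'rV[R]_4 := \row_j [:: 0; 0; 1; s]`_j.

Definition base_point : 'rV[R]_3 := \row_j [:: 0; 0; 1]`_j.

Lemma coord_proj_fibre_point (s : R) :
  coord_proj (leqnSn 3) (fibre_point s) = base_point.
Proof. by apply/rowP => -[[|[|[|]]] //= i]; rewrite !mxE. Qed.

Definition fibre_direction (s : R) : 'rV[R]_4 := \row_j [:: 1; s; 0; 0]`_j.

(** The point is [(t, t * s, 1, s)]: its slope is [s] whatever [t > 0] is, and [s ^+ 2 = 1] puts it
    on the surface at height 1. *)
Lemma slope_cell_ray (s t : R) : s ^+ 2 = 1 -> 0 < t ->
  slope_cell (fibre_point s + t *: fibre_direction s).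
Proof.
move=> s1 t0; rewrite slope_cellE /= /slope !mxE /=.
have -> : (0 + t * s) / (0 + t * 1) = s by field; rewrite gt_eqF.
by split; rewrite ?s1; lra.
Qed.

(** Unlike [w = y / x], the relation [z = w^2] involves no denominator: it defines a closed set
    containing the cell, so it survives at limit points with [x = 0]. *)
Lemma closure_slope_cell (z : 'rV[R]_4) :
  closure slope_cell z -> z 0 2 = z 0 ord_max ^+ 2.
Proof.
have cont v : {for v, continuous (fun v : 'rV[R]_4 => v 0 2 - v 0 ord_max ^+ 2)}.
  apply: continuousB; first exact: coord_continuous.
  by apply: continuousM; exact: coord_continuous.
have closedE : closed [set v : 'rV[R]_4 | v 0 2 - v 0 ord_max ^+ 2 = 0].
  by apply: (preimage_closed _ (@closed_eq R 0)) => v _; exact: cont.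
rewrite closureE => Cz; apply/subr0_eq; apply: (Cz _ (conj closedE _)).
by rewrite slope_cellE => v [_ v2 v3] /=; rewrite v2 v3 subrr.
Qed.

Lemma closure_slope_cell_fibre :
  closure slope_cell `&` coord_proj (leqnSn 3) @^-1` [set base_point] =
  [set fibre_point 1; fibre_point (-1)].
Proof.
apply/seteqP; split=> [z [/closure_slope_cell zE /= zb]|z].
  have zi i := congr1 (fun v : 'rV[R]_3 => v 0 i) zb.
  have z0 := zi 0; have z1 := zi 1; have z2 := zi ord_max.
  rewrite !mxE /= in z0 z1 z2.
  (* The first three coordinates are fixed by the base point, so only the last one is free; the
     closed relation at height 1 then forces its square to be 1. *)
  have zP s : z 0 ord_max = s -> z = fibre_point s.
    move=> zs; apply/rowP => -[[|[|[|[|]]]] //= i]; rewrite mxE /=.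
    - by rewrite -z0; congr (z 0 _); exact: val_inj.
    - by rewrite -z1; congr (z 0 _); exact: val_inj.
    - by rewrite -z2; congr (z 0 _); exact: val_inj.
    - by rewrite -zs; congr (z 0 _); exact: val_inj.
  have : z 0 ord_max ^+ 2 = 1.
    by rewrite -zE -z2; congr (z 0 _); exact: val_inj.
  by move/eqP; rewrite sqrf_eq1 => /orP[] /eqP /zP; [left|right].
(* Conversely, each root [s] of 1 is reached along the ray of slope [s]. *)
have mem s : s ^+ 2 = 1 -> (closure slope_cell `&`
    coord_proj (leqnSn 3) @^-1` [set base_point]) (fibre_point s).
  move=> s1; split; last exact: coord_proj_fibre_point.
  by apply: (closure_ray _ _ _ _ (fibre_direction s)) => t; exact: slope_cell_ray.
by case=> ->; apply: mem; rewrite ?sqrrN expr1n.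
Qed.

(** The projection is linear, so it carries the ray of slope 1 in the cell to a ray issuing from the
    base point. *)
Lemma closure_base_point :
  closure (coord_proj (leqnSn 3) @` slope_cell) base_point.
Proof.
apply: (closure_ray _ _ _ _ (coord_proj (leqnSn 3) (fibre_direction 1))) => t t0.
exists (fibre_point 1 + t *: fibre_direction 1).
  by apply: slope_cell_ray => //; rewrite expr1n.
by rewrite -(coord_proj_fibre_point 1); apply/rowP => i; rewrite !mxE.
Qed.

End Cell.

Theorem proposition3p5 (R : realType) :
  exists (C : set 'rV[R]_4) (x : 'rV[R]_3),
    let pi3 := @coord_proj R 3 4 (leqnSn 3) in
    let fibre := closure C `&` pi3 @^-1` [set x] in
    [/\ cad_cell C,
        closure (pi3 @` C) x,
        exists p q : 'rV[R]_4, p <> q /\ fibre = [set p; q]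
      & ~ closed_segment fibre].
Proof.
have point_neq : fibre_point R 1 <> fibre_point R (-1).
  by move=> /rowP /(_ ord_max); rewrite !mxE /=; lra.
exists (slope_cell R), (base_point R) => /=; rewrite closure_slope_cell_fibre.
split; [exact: cad_cell_slope_cell|exact: closure_base_point| |].
  by exists (fibre_point R 1), (fibre_point R (-1)).
exact: doubleton_not_closed_segment.
Qed.
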